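(* Let $G$ be a finite abelian group and $F_G$ its Fourier matrix. For each prime $p$, write the $p$-component (Sylow $p$-subgroup) of $G$ as $G_p=\mathbb Z_{p^{a_1}}\times\ldots\times\mathbb Z_{p^{a_r}}$ with $a_1\leq a_2\leq\ldots\leq a_r$ (here $r$ and the $a_k$ depend on $p$), and set $a_0=0$. Then $$d(F_G)=|G|\prod_p\left( 1+\sum_{k=1}^rp^{(r-k)a_{k-1}+(a_1+\ldots+a_{k-1})-1}(p^{r-k+1}-1)[a_k-a_{k-1}]_{p^{r-k}}\right),$$ where $[a]_q=1+q+q^2+\ldots+q^{a-1}$ (so $[0]_q=0$).
   Context: A complex Hadamard matrix is $H\in M_N(\mathbb C)$ with all $|H_{ij}|=1$ and pairwise orthogonal rows. For $G=\mathbb Z_{N_1}\times\ldots\times\mathbb Z_{N_r}$ (any finite abelian group, $N=|G|$), the Fourier matrix $F_G\in M_N(\mathbb C)$ has rows and columns indexed by $G$ with entries $(F_G)_{i,j}=\prod_{s=1}^r e^{2\pi i\, i_sj_s/N_s}$, i.e. $F_G=F_{N_1}\otimes\ldots\otimes F_{N_r}$ with $F_n=(e^{2\pi i\,ab/n})_{a,b=0}^{n-1}$. The undephased defect of a complex Hadamard matrix $H\in M_N(\mathbb C)$ is $d(H)=\dim_{\mathbb R}\widetilde T_HC_N$, where $C_N=M_N(\mathbb T)\cap\sqrt N U_N$ and $\widetilde T_HC_N=T_HM_N(\mathbb T)\cap T_H\sqrt NU_N$ (intersection of the real tangent spaces at $H$ of the torus $M_N(\mathbb T)$ and of the manifold $\sqrt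 N U_N$ inside $M_N(\mathbb C)\cong\mathbb R^{2N^2}$). Equivalently (Tadej–Życzkowski), $d(H)$ is the dimension of the real vector space $\{A\in M_N(\mathbb R):\ \sum_kH_{ik}\bar H_{jk}(A_{ik}-A_{jk})=0\ \forall i,j\}$. The product is over all primes $p$; for $p\nmid |G|$ one has $r=0$ and the factor is $1$. *)

(* Defs.v *)
From HB Require Import structures.
From mathcomp Require Import all_boot all_order all_algebra all_fingroup.
From mathcomp Require Import all_solvable.
From mathcomp Require Import spectral.
From mathcomp Require Import all_classical all_reals all_analysis.
From mathcomp.real_closed Require Import complex.

Set Implicit Arguments.
Unset Strict Implicit.
Unset Printing Implicit Defensive.

Import Order.TTheory GRing.Theory Num.Theory numFieldNormedType.Exports.

Local Open Scope classical_set_scope.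
Local Open Scope ring_scope.
Local Open Scope complex_scope.

(* Zprod [:: N_1; ...; N_r] is the group Z_{N_1} x ... x Z_{N_r}: the type
   'I_m.+1 carries addition modulo m.+1 as its group law, and n.-1.+1 = n
   whenever 0 < n.  ('Z_n is avoided because 'Z_1 has two elements.) *)
Definition Zprod (N : seq nat) : finGroupType :=
  {dffun forall s : 'I_(size N), 'I_(nth 0%N N s).-1.+1}.

Definition Zcoord (N : seq nat) (x : Zprod N) (s : 'I_(size N)) : nat :=
  (x : {dffun forall s : 'I_(size N), 'I_(nth 0%N N s).-1.+1}) s.

Section Defect.
Variable R : realType.

Definition expi (x : R) : R[i] := cos x +i* sin x.

Definition fourier (N : seq nat) : 'M[R[i]]_#|Zprod N| :=
  \matrix_(i, j) \prod_(s < size N)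
    expi (2 * pi * (Zcoord (enum_val i) s * Zcoord (enum_val j) s)%:R
          / (nth 0%N N s)%:R).

Variable n : nat.
Implicit Types (M : set 'M[R[i]]_n) (H X : 'M[R[i]]_n).

Definition torus : set 'M[R[i]]_n := [set H | forall i j, `|H i j| = 1].

Definition scaled_unitary : set 'M[R[i]]_n :=
  [set sqrtC n%:R *: U | U in [set U : 'M[R[i]]_n | U \is unitarymx]].

(* Velocities at time 0 of the curves in M through H; the derivative is the
   real one, in the coordinates given by the real and imaginary parts of the
   entries. *)
Definition tangent M H : set 'M[R[i]]_n :=
  [set X | exists c : R -> 'M[R[i]]_n,
    [/\ c 0 = H,
        \forall t \near (0 : R), M (c t),
        forall i j, is_derive (0 : R) (1 : R)
          (fun t => complex.Re (c t i j)) (complex.Re (X i j)) &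
        forall i j, is_derive (0 : R) (1 : R)
          (fun t => complex.Im (c t i j)) (complex.Im (X i j))]].

(* Here S is identified with a subset of R^(2n^2) by taking real and imaginary
   parts. *)
Definition has_real_dim (S : set 'M[R[i]]_n) (d : nat) : Prop :=
  exists U : {vspace ('M[R]_n * 'M[R]_n)%type},
    (forall X, S X <->
      (map_mx (@complex.Re R) X, map_mx (@complex.Im R) X) \in U) /\
    \dim U = d.

(* The value is 0 if S is not a real linear subspace. *)
Definition real_dim (S : set 'M[R[i]]_n) : nat :=
  xget 0%N [set d | has_real_dim S d].

Definition defect H : nat :=
  real_dim (tangent torus H `&` tangent scaled_unitary H).

End Defect.

Definition qint (q a : nat) : nat := (\sum_(i < a) q ^ i)%N.

(* The list a = [:: a_1; ...; a_r] is extended by a_0 = 0; for k = 1 the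
   exponent of p is -1, hence the integer power of a rational. *)
Definition local_factor (p : nat) (a : seq nat) : rat :=
  let r := size a in
  let a_ k := nth 0%N (0%N :: a) k in
  1 + \sum_(1 <= k < r.+1)
    p%:R ^ (((r - k) * a_ k.-1 + \sum_(1 <= j < k) a_ j)%N%:Z - 1)
    * (p%:R ^+ (r - k + 1) - 1) * (qint (p ^ (r - k)) (a_ k - a_ k.-1))%:R.

(* Main.v *)
(* Curves t |-> H exp(i t A) in the torus and t |-> U_t H in sqrt(n) U_n, with
   U_t a Cayley transform, realize every tangent vector allowed by the
   linearized equations, so the enveloping tangent space at F_G is the space of
   the X = i A F_G (entrywise) with A real and
   sum_k chi_{x - y}(k) (A(x,k) - A(y,k)) = 0 for all x, y.  After a transform
   of the rows of A by the real kernel cas = Re chi + Im chi, which is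
   orthogonal up to a factor |G|, this says that the g-th coefficient of row x
   only depends on the coset of x modulo <g>.  Hence
   d(F_G) = sum_g |G : <g>| = |G| sum_g 1/ord(g).
   The last sum is multiplicative over the Sylow subgroups.  On a p-group with
   p^f(s) solutions of x^(p^s) = 1, it equals
   1 + sum_s (p^f(s+1) - p^f(s)) / p^(s+1); for prod_k Z_{p^{a_k}} one has
   f(s) = sum_k min(a_k, s), and splitting the range of s at the a_k gives the
   geometric sums of the local factor. *)
Require Import Defs.
From HB Require Import structures.
From mathcomp Require Import all_boot all_order all_algebra all_fingroup.
From mathcomp Require Import all_solvable ring lra.
From mathcomp Require Import spectral.
From mathcomp Require Import all_classical all_reals all_analysis.
From mathcomp.real_closed Require Import complex.

Set Implicit Arguments.
Unset Strict Implicit.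
Unset Printing Implicit Defensive.

Import Order.TTheory GRing.Theory Num.Theory numFieldNormedType.Exports.

Local Open Scope ring_scope.

(** * Sums of inverse orders in finite abelian groups *)

Section InvOrderSum.
Local Open Scope group_scope.

Definition inv_order_sum (gT : finGroupType) (A : {set gT}) : rat :=
  (\sum_(x in A) (#[x]%:R)^-1)%R.

Lemma inv_order_sum1 (gT : finGroupType) : inv_order_sum [1 gT] = 1%R.
Proof. by rewrite /inv_order_sum big_set1 order1 invr1. Qed.

Lemma inv_order_sum_isog (gT rT : finGroupType) (G : {group gT})
    (H : {group rT}) :
  G \isog H -> inv_order_sum G = inv_order_sum H.
Proof.
case/isogP=> f injf <-; rewrite /inv_order_sum morphimEdom big_imset /=.
  by apply: eq_bigr => x Gx; rewrite order_injm.
exact/injmP.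
Qed.

(** Commuting elements of coprime orders satisfy ord(kh) = ord(k) ord(h), so the sum factors. *)
Lemma inv_order_sum_dprod (gT : finGroupType) (K H G : {group gT}) :
  K \x H = G -> coprime #|K| #|H| ->
  inv_order_sum G = (inv_order_sum K * inv_order_sum H)%R.
Proof.
case/dprodP=> _ <- cKH tiKH coKH.
have -> : (K * H)%g = (fun u : gT * gT => u.1 * u.2) @: finset.setX K H.
  apply/setP=> x; apply/mulsgP/imsetP=> [[k h Kk Hh ->]|[[k h]]].
    by exists (k, h); rewrite ?inE ?Kk.
  by rewrite !inE /= => /andP[Kk Hh] ->; exists k h.
rewrite /inv_order_sum big_imset /=; last first.
  move=> [k h] [k' h']; rewrite !inE /= => /andP[Kk Hh] /andP[Kk' Hh'] eq_kh.
  have e : k'^-1 * k = h' * h^-1.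
    by apply: (mulIg h); rewrite -mulgA eq_kh mulgKV mulKg.
  have : k'^-1 * k \in K :&: H by rewrite inE {2}e !groupM ?groupV.
  rewrite tiKH inE e -eq_mulgV1 => /eqP h_eq.
  by move: eq_kh; rewrite h_eq => /mulIg ->.
rewrite big_distrlr /= pair_big_dep /=.
apply: eq_big => [[k h]|[k h]]; rewrite !inE //=.
case/andP=> Kk Hh; rewrite orderM ?natrM ?invfM //.
  exact/commute_sym/(centsP cKH).
exact: coprime_dvdl (order_dvdG Kk) (coprime_dvdr (order_dvdG Hh) coKH).
Qed.

(** The product over primes is built one natural number at a time; for non-prime [n] no prime
    divides the order of the [n]-core, so that step contributes 1. *)
Lemma inv_order_sum_pcore_nonprime (gT : finGroupType) (G : {group gT}) n :
  ~~ prime n -> inv_order_sum (pcore n G) = 1%R.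
Proof.
move=> n_np; rewrite (_ : (pcore n G) = 1) ?inv_order_sum1 //.
apply/eqP; rewrite trivg_card1; apply/eqP/(pnat_1 (pcore_pgroup n G)).
by apply/pnatP=> // p p_pr _; apply: contraNneq n_np => <-.
Qed.

Lemma inv_order_sum_nilpotent (gT : finGroupType) (G : {group gT}) :
  nilpotent G ->
  inv_order_sum G =
  (\prod_(p < #|G|.+1 | prime p) inv_order_sum (pcore p G))%R.
Proof.
move=> nilG; have step n : inv_order_sum (pcore [pred q | (q < n)%N] G) =
    (\prod_(p < n | prime p) inv_order_sum (pcore p G))%R.
  elim: n => [|n IHn].
    rewrite big_ord0 -(inv_order_sum1 gT); congr inv_order_sum.
    apply/eqP; rewrite trivg_card1; apply/eqP.
    apply: (@pnat_1 [pred q | q < 0]%N); first exact: pcore_pgroup.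
    by apply/pnatP.
  (* [K] is the core for the primes at most [n]; nilpotency splits it into its [n]-core and the core
     for the primes below [n]. *)
  pose K := [group of pcore [pred q | (q < n.+1)%N] G].
  have nilK : nilpotent K by apply: nilpotentS (pcore_sub _ _) nilG.
  have lt_n : pcore n^' K = pcore [pred q | (q < n)%N] G.
    rewrite -pcoreI; apply: eq_pcore => q.
    by rewrite !inE ltnS ltn_neqAle.
  have at_n : pcore n K = pcore n G.
    rewrite -pcoreI; apply: eq_pcore => q.
    by rewrite !inE ltnS; apply: andb_idr => /eqP->.
  rewrite (inv_order_sum_dprod (nilpotent_pcoreC n nilK)) ?coprime_pcoreC //.
  rewrite /= lt_n at_n IHn big_mkcond [RHS]big_mkcond big_ord_recr /= mulrC.
  by case: ifP => // /negbT /inv_order_sum_pcore_nonprime ->.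
(* Every prime divisor of |G| is below |G| + 1, so the core at this bound is [G] itself. *)
rewrite -step pcore_pgroup_id //; apply/pgroupP => p p_pr pG.
by rewrite inE ltnS dvdn_leq.
Qed.

End InvOrderSum.

(** * Numbers of solutions of x^(p^s) = 1 in products of cyclic p-groups *)

Lemma card_expg_ord (d q : nat) : (0 < d)%N -> (0 < q)%N ->
  #|[set x : 'I_(q * d).-1.+1 | (x ^+ d == 1)%g]%SET| = d.
Proof.
move=> d_gt0 q_gt0; have qd : (q * d).-1.+1 = (q * d)%N.
  by rewrite prednK ?muln_gt0 ?q_gt0.
(* In the cyclic group of order qd the solutions are the multiples of q. *)
pose f (j : 'I_d) : 'I_(q * d).-1.+1 := inord (q * j).
have fE j : f j = (q * j)%N :> nat.
  by rewrite inordK // qd ltn_pmul2l.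
rewrite -[RHS]card_ord -cardsT -(card_imset _ (_ : injective f)); last first.
  move=> i j /(congr1 val); rewrite /= !fE => /eqP.
  by rewrite eqn_pmul2l // => /eqP /val_inj.
congr #|pred_of_set _|; apply/setP=> x; rewrite inE Zp_expg -val_eqE /=.
have modE m : (m %% (q * d).-1.+1 = m %% (q * d))%N by rewrite qd.
apply/eqP/imsetP => [|[j _ ->]]; rewrite modE; last first.
  by rewrite fE mulnAC modnMr.
move/eqP; rewrite -/(dvdn _ _) dvdn_pmul2r // => /dvdnP[j xE].
have j_lt : (j < d)%N.
  by rewrite -(ltn_pmul2l q_gt0) mulnC -xE -[X in (_ < X)%N]qd.
by exists (Ordinal j_lt); rewrite //; apply/val_inj; rewrite /= fE xE mulnC.
Qed.

Lemma card_expg_ord_ppow (p k s : nat) : prime p ->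
  #|[set x : 'I_(p ^ k).-1.+1 | (x ^+ (p ^ s) == 1)%g]%SET| = (p ^ minn k s)%N.
Proof.
move=> p_pr; have p_gt0 n : (0 < p ^ n)%N by rewrite expn_gt0 prime_gt0.
have [sk|ks] := leqP s k.
  by rewrite -(subnK sk) expnD card_expg_ord.
rewrite -[X in _ = X]prednK // -[RHS]card_ord -cardsT.
apply: eq_card => x; rewrite !inE Zp_expg -val_eqE /= -(subnK (ltnW ks)) expnD.
have modE m : (m %% (p ^ k).-1.+1 = m %% p ^ k)%N by rewrite prednK.
by rewrite modE mulnA modnMl.
Qed.

Lemma Zprod_expgE (N : seq nat) (x : Zprod N) n i : (x ^+ n)%g i = (x i ^+ n)%g.
Proof.
elim: n => [|n IHn]; first by rewrite !expg0 ffunE.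
by rewrite !expgS ffunE IHn.
Qed.

Lemma card_expg_Zprod_ppow (p s : nat) (a : seq nat) : prime p ->
  #|[set x : Zprod [seq (p ^ k)%N | k <- a] | (x ^+ (p ^ s) == 1)%g]%SET| =
  (p ^ \sum_(i < size a) minn (nth 0 a i) s)%N.
Proof.
move=> p_pr; set N := [seq _ | _ <- _].
have -> : [set x : Zprod N | (x ^+ (p ^ s) == 1)%g]%SET =
    setXn (fun i : 'I_(size N) =>
      [set y : 'I_(nth 0%N N i).-1.+1 | (y ^+ (p ^ s) == 1)%g]%SET).
  apply/setP => x; rewrite inE in_setXn; apply/eqP/forallP => [x1 i|x1].
    by rewrite inE -Zprod_expgE x1 ffunE.
  apply/ffunP => i; rewrite Zprod_expgE ffunE; apply/eqP.
  by have := x1 i; rewrite inE.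
rewrite cardsXn expn_sum.
pose F i := #|[set y : 'I_(nth 0%N N i).-1.+1 | (y ^+ (p ^ s) == 1)%g]%SET|.
rewrite -(big_mkord xpredT F).
rewrite -(big_mkord xpredT (fun i => p ^ minn (nth 0 a i) s)%N).
rewrite size_map !big_nat; apply: eq_bigr => i i_lt.
by rewrite /F (nth_map 0%N) // card_expg_ord_ppow.
Qed.

(* With [p ^ e] the order of [x], the condition [e <= s] reads
   [x ^+ (p ^ s) = 1], so that summing over [x] brings in the solution counts. *)
Lemma inv_ppow_telescope (p e M : nat) : (e <= M)%N ->
  (p%:R ^- e)%R =
  (p%:R ^- M + \sum_(s < M | (e <= s)%N) (p%:R ^- s - p%:R ^- s.+1))%R :> rat.
Proof.
elim: M => [|M IHM]; first by rewrite leqn0 => /eqP ->; rewrite big_ord0 addr0.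
rewrite leq_eqVlt big_mkcond big_ord_recr -big_mkcond /= => /predU1P[->|].
  rewrite ltnn addr0 big_pred0 ?addr0 // => i.
  by apply/negbTE; rewrite -ltnNge ltnS ltnW.
by rewrite ltnS => eM; rewrite {1}IHM // eM [RHS]addrCA subrKC addrC.
Qed.

(** Expanding each inverse order by the telescoping identity and exchanging sums gives a weighted
    sum of the counts p^f(s); summation by parts turns it into a sum of their increments. *)
Lemma inv_order_sum_ppow (gT : finGroupType) (p M : nat) (f : nat -> nat) :
  prime p ->
  (forall x : gT, (x ^+ (p ^ M))%g = 1%g) ->
  (forall s, #|[set x : gT | (x ^+ (p ^ s) == 1)%g]%SET| = (p ^ f s)%N) ->
  inv_order_sum [set: gT] =
  1 + \sum_(s < M) (p ^ f s.+1 - p ^ f s)%N%:R * p%:R ^- s.+1.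
Proof.
move=> p_pr exp_pM cardE.
have -> : inv_order_sum [set: gT] =
    (p ^ f M)%:R * p%:R ^- M +
    \sum_(s < M) (p ^ f s)%:R * (p%:R ^- s - p%:R ^- s.+1).
  have termE (x : gT) : x \in [set: gT] -> ((#[x]%g)%:R^-1 =
      p%:R ^- M + \sum_(s < M) (if (x ^+ (p ^ s) == 1)%g then
         p%:R ^- s - p%:R ^- s.+1 else 0) :> rat)%R.
    move=> _; have /(dvdn_pfactor _ _ p_pr)[e eM oxE] : (#[x]%g %| p ^ M)%N.
      by rewrite order_dvdn exp_pM.
    rewrite -big_mkcond oxE natrX (inv_ppow_telescope p eM); congr (_ + _).
    apply: eq_bigl => s; rewrite -order_dvdn oxE.
    by rewrite dvdn_Pexp2l ?prime_gt1.
  rewrite /inv_order_sum (eq_bigr _ termE) big_split /= exchange_big /=.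
  congr (_ + _).
    rewrite sumr_const -[LHS]mulr_natl -cardE.
    by congr (_%:R * _); apply: eq_card => x; rewrite !inE exp_pM eqxx.
  apply: eq_bigr => s _; rewrite -big_mkcondr sumr_const -[LHS]mulr_natl.
  rewrite -cardE; congr (_%:R * _); apply: eq_card => x.
  by rewrite [LHS]unfold_in !inE.
have f0 : (p ^ f 0 = 1)%N.
  rewrite -cardE -(cards1 (1%g : gT)); apply: eq_card => x.
  by rewrite !inE expg1.
have f_le s : (p ^ f s <= p ^ f s.+1)%N.
  rewrite -!cardE; apply/subset_leq_card/fintype.subsetP => x.
  rewrite !inE => /eqP x1.
  by rewrite expnSr expgM x1 expg1n.
(* Summation by parts: [f0] gives the boundary term 1, and [f_le] makes the natural subtractions
   exact. *)
elim: (M) => [|m IHm]; first by rewrite !big_ord0 f0 expr0 invr1 mulr1.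
rewrite !big_ord_recr /= [RHS]addrA -IHm natrB //.
by ring.
Qed.

Lemma sum_nat_subdiv (b : nat -> nat) (r : nat) (F : nat -> rat) :
  b 0%N = 0%N -> (forall k, (k < r)%N -> (b k <= b k.+1)%N) ->
  \sum_(0 <= s < b r) F s =
  \sum_(1 <= k < r.+1) \sum_(b k.-1 <= s < b k) F s.
Proof.
move=> b0; elim: r => [|r IHr] b_mono; first by rewrite b0 !big_geq.
rewrite big_nat_recr //= -IHr => [|k k_lt]; last exact/b_mono/ltnW.
by rewrite -big_cat_nat // b_mono.
Qed.

(** Between consecutive exponents [f] is affine, so the k-th block of the sum is geometric with
    ratio p^(r - k). *)
Lemma inv_order_sum_Zprod_ppow (p : nat) (a : seq nat) :
  prime p -> sorted leq a ->
  inv_order_sum [set: Zprod [seq (p ^ k)%N | k <- a]]%SET = local_factor p a.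
Proof.
move=> p_pr a_sorted; set r := size a; pose b k := nth 0%N (0%N :: a) k.
have b_mono i j : (i <= j <= r)%N -> (b i <= b j)%N.
  case/andP=> ij jr; apply: (sorted_leq_nth leq_trans leqnn) => //.
    by rewrite /= path_min_sorted //; apply/allP.
  by rewrite inE /= ltnS (leq_trans ij).
pose f s := (\sum_(i < r) minn (nth 0 a i) s)%N.
have f_eq s : f s = (\sum_(1 <= j < r.+1) minn (b j) s)%N.
  by rewrite big_add1 /= big_mkord.
have cardE s := card_expg_Zprod_ppow s a p_pr.
(* The largest exponent [b r] serves as the bound, since p^(b r) annihilates the group; for empty
   [a] it is 0. *)
rewrite (inv_order_sum_ppow (M := b r) (f := f) p_pr) //; last first.
  move=> x; apply/ffunP => i; rewrite Zprod_expgE ffunE.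
  have ir : (i < r)%N by have := ltn_ord i; rewrite [X in (_ < X)%N]size_map.
  have Ni : (nth 0 [seq (p ^ k)%N | k <- a] i).-1.+1 = (p ^ nth 0 a i)%N.
    by rewrite (nth_map 0%N) // prednK // expn_gt0 prime_gt0.
  apply/eqP; rewrite -order_dvdn.
  apply: dvdn_trans (order_dvdG (finset.in_setT _)) _.
  rewrite cardsT card_ord Ni dvdn_exp2l //.
  by apply: (b_mono i.+1); rewrite ir leqnn.
rewrite /local_factor -/r; congr (1 + _).
pose F s : rat := (p ^ f s.+1 - p ^ f s)%N%:R * p%:R ^- s.+1.
rewrite -(big_mkord xpredT F).
rewrite (sum_nat_subdiv (b := b)) // => [|k kr]; last by rewrite b_mono // leqnSn.
rewrite !big_nat; apply: eq_bigr => k /andP[k_gt0 kr]; rewrite ltnS in kr.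
have b_le : (b k.-1 <= b k)%N by rewrite b_mono // leq_pred.
pose S := (\sum_(1 <= j < k) b j)%N.
(* In the k-th block the first k - 1 minima equal b_j and the other r - k + 1 equal s. Both ends are
   included, since f(s) and f(s + 1) are both evaluated. *)
have fE s : (b k.-1 <= s <= b k)%N -> f s = (S + (r - k + 1) * s)%N.
  case/andP=> ks sk; rewrite f_eq (big_cat_nat (n := k)) //= ?(leqW kr) //.
  congr (_ + _)%N.
    rewrite /S !big_nat; apply: eq_bigr => j /andP[j0 jk].
    apply/minn_idPl/(leq_trans _ ks)/b_mono.
    by rewrite -ltnS prednK // jk (leq_trans (leq_pred _)).
  rewrite addn1 -subSn // -sum_nat_const_nat !big_nat.
  apply: eq_bigr => j /andP[kj jr].
  by apply/minn_idPr/(leq_trans sk)/b_mono; rewrite kj.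
have p_neq0 : p%:R != 0 :> rat by rewrite pnatr_eq0 -lt0n prime_gt0.
rewrite /F /qint natr_sum mulr_sumr -{1}[b k.-1]add0n big_addn big_mkord.
apply: eq_bigr => i _; have := ltn_ord i; rewrite ltn_subRL => i_lt.
set m := b k.-1 in i_lt *; set t := (r - k)%N in fE *.
rewrite !fE; last 2 first.
- by rewrite leq_addl addnC ltnW.
- by rewrite leqW ?leq_addl //= addnC.
rewrite natrB ?leq_exp2l ?prime_gt1 ?leq_add2l ?leq_mul2l ?leqnSn ?orbT //.
rewrite -[nth _ _ k.-1]/m -[(\sum_(1 <= j < k) nth _ _ j)%N]/S.
rewrite !natrX expfzDr // exprN1 -exprnP -exprM !addn1.
rewrite (mulnS t.+1) !(mulSn, mulnDr) !(exprS _ t, exprS _ (i + m)) !exprD !exprS.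
field.
by rewrite !expf_neq0 p_neq0.
Qed.

Lemma Zprod_abelian (N : seq nat) : abelian [set: Zprod N]%SET.
Proof.
apply/centsP=> x _ y _; apply/ffunP => i; rewrite !ffunE.
by apply: val_inj; rewrite /= addnC.
Qed.

Lemma inv_order_sum_abelian (gT : finGroupType) (G : {group gT})
    (a : nat -> seq nat) :
  abelian G ->
  (forall p, prime p -> sorted leq (a p)) ->
  (forall p, prime p ->
     exists2 P : {group gT}, (p.-Sylow(G) P)%g &
       (P \isog [set: Zprod [seq (p ^ k)%N | k <- a p]]%SET)%g) ->
  inv_order_sum G =
  \big[*%R/1]_(p \in [set p | prime p]%classic) local_factor p (a p).
Proof.
move=> abG a_sorted G_p; have nilG := abelian_nil abG.
have coreE p : prime p -> inv_order_sum (pcore p G) = local_factor p (a p).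
  move=> p_pr; have [P sylP isoP] := G_p p p_pr.
  rewrite -(eq_Hall_pcore (nilpotent_pcore_Hall p nilG) sylP).
  rewrite (inv_order_sum_isog isoP).
  exact: inv_order_sum_Zprod_ppow (a_sorted p p_pr).
rewrite inv_order_sum_nilpotent //.
rewrite (fsbigE [seq p <- index_iota 0 #|G|.+1 | prime p]).
- rewrite big_filter_cond big_mkord.
  apply: eq_big => [p|p p_pr]; last exact: coreE.
  by rewrite /= andb_idr // => p_pr; rewrite inE.
- by rewrite filter_uniq ?iota_uniq.
- by move=> p /=; rewrite mem_filter => /andP[].
(* For a prime beyond |G| the list [a p] may still contain zeros, so its factor is computed through
   [coreE] from the trivial core. *)
move=> p; rewrite mem_filter mem_index_iota /= => p_pr.
rewrite p_pr ltnS -ltnNge => G_lt_p.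
rewrite -coreE // (_ : pcore p G = 1%g) ?inv_order_sum1 //.
apply/eqP; rewrite trivg_card1 (card_Hall (nilpotent_pcore_Hall p nilG)).
by rewrite p_part lognE p_pr cardG_gt0 gtnNdvd.
Qed.

(** * Tangent spaces of the torus and of the scaled unitary group *)

Section Tangent.
Variable R : realType.
Local Open Scope complex_scope.
Local Open Scope sesquilinear_scope.

(** An explicit second-order remainder bound yields the derivative; the Cayley curve below is
    thereby differentiated without differentiating a matrix inverse. *)
Lemma is_derive_quadratic (f : R -> R) (l C : R) :
  (forall t, `|f t - f 0 - t * l| <= C * t ^+ 2) ->
  is_derive (0 : R) (1 : R) f l.
Proof.
move=> fC.
have lim_l : (h^-1 *: ((f \o shift 0) (h *: (1 : R)) - f 0)
    @[h --> 0^'] --> l)%classic.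
  apply/cvgrPdist_le => e e_gt0; near=> h.
  have h_neq0 : h != 0 by near: h; exact: nbhs_dnbhs_neq.
  have h_lt : `|h| < e / (`|C| + 1).
    by near: h; apply: dnbhs0_lt; rewrite divr_gt0 // ltr_wpDl.
  have -> : l - h^-1 *: ((f \o shift 0) (h *: (1 : R)) - f 0) =
      - (h^-1 * (f h - f 0 - h * l)).
    by rewrite /= /shift /= addr0 /GRing.scale /= mulr1; field.
  rewrite normrN normrM normfV mulrC ler_pdivrMr ?normr_gt0 //.
  apply: le_trans (fC h) _; rewrite -real_normK ?num_real //.
  rewrite expr2 mulrA ler_wpM2r //.
  rewrite ltr_pdivlMr in h_lt; last by rewrite ltr_wpDl.
  rewrite ltW // (le_lt_trans _ h_lt) //.
  apply: (@le_trans _ _ (`|C| * `|h|)); first by rewrite ler_wpM2r // ler_norm.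
  by rewrite mulrC ler_wpM2l // lerDl.
by apply: DeriveDef; [apply: cvgP lim_l|apply: cvg_lim lim_l].
Unshelve. all: by end_near.
Qed.

(** * Real derivatives of complex-valued curves at time 0 *)

Definition cderiv (f : R -> R[i]) (x : R[i]) : Prop :=
  is_derive (0 : R) (1 : R) (fun t => complex.Re (f t)) (complex.Re x) /\
  is_derive (0 : R) (1 : R) (fun t => complex.Im (f t)) (complex.Im x).

Lemma ReD (z w : R[i]) : complex.Re (z + w) = complex.Re z + complex.Re w.
Proof. by case: z w => ? ? []. Qed.

Lemma ImD (z w : R[i]) : complex.Im (z + w) = complex.Im z + complex.Im w.
Proof. by case: z w => ? ? []. Qed.

Lemma Re_sum (I : Type) (r : seq I) (P : pred I) (F : I -> R[i]) :
  complex.Re (\sum_(i <- r | P i) F i) = \sum_(i <- r | P i) complex.Re (F i).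
Proof. exact: (big_morph _ ReD). Qed.

Lemma Im_sum (I : Type) (r : seq I) (P : pred I) (F : I -> R[i]) :
  complex.Im (\sum_(i <- r | P i) F i) = \sum_(i <- r | P i) complex.Im (F i).
Proof. exact: (big_morph _ ImD). Qed.

Lemma ReMJ (z w : R[i]) :
  complex.Re (z * w^*%R) =
  complex.Re z * complex.Re w + complex.Im z * complex.Im w.
Proof. by case: z w => a b [c d] /=; rewrite mulrN opprK. Qed.

Lemma ImMJ (z w : R[i]) :
  complex.Im (z * w^*%R) =
  complex.Im z * complex.Re w - complex.Re z * complex.Im w.
Proof. by case: z w => a b [c d] /=; rewrite mulrN addrC. Qed.

(** This form of the product rule fits both constraints: unit modulus of the entries and inner
    products of rows. *)
Lemma cderivMJ f g x y : cderiv f x -> cderiv g y ->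
  cderiv (fun t => f t * (g t)^*%R) (x * (g 0)^*%R + f 0 * y^*%R).
Proof.
move=> [f1 f2] [g1 g2]; split.
  under eq_fun do rewrite ReMJ.
  have D := (is_deriveD (is_deriveM f1 g1) (is_deriveM f2 g2)).
  apply: (is_derive_eq D).
  by rewrite ReD !ReMJ /GRing.scale /=; ring.
under eq_fun do rewrite ImMJ.
have D := (is_deriveB (is_deriveM f2 g1) (is_deriveM f1 g2)).
apply: (is_derive_eq D).
by rewrite ImD !ImMJ /GRing.scale /=; ring.
Qed.

Lemma cderiv_sum n (f : 'I_n -> R -> R[i]) (x : 'I_n -> R[i]) :
  (forall k, cderiv (f k) (x k)) ->
  cderiv (fun t => \sum_k f k t) (\sum_k x k).
Proof.
move=> df; split.
  under eq_fun do rewrite Re_sum.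
  rewrite Re_sum -fct_sumE; apply: is_derive_sum => k; exact: (df k).1.
under eq_fun do rewrite Im_sum.
rewrite Im_sum -fct_sumE; apply: is_derive_sum => k; exact: (df k).2.
Qed.

(** Turns a constraint holding along a curve near 0 into a linear equation on its velocity. *)
Lemma cderiv_near_cst f x (y : R[i]) :
  cderiv f x -> (\forall t \near (0 : R), f t = y) -> x = 0.
Proof.
move=> [f1 f2] fy.
have d1 : is_derive (0 : R) (1 : R) (cst (complex.Re y)) (complex.Re x).
  by apply: near_eq_is_derive f1; apply: filterS fy => t ->.
have d2 : is_derive (0 : R) (1 : R) (cst (complex.Im y)) (complex.Im x).
  by apply: near_eq_is_derive f2; apply: filterS fy => t ->.
apply/eqP; rewrite eq_complex -(derive_val (is_derive := d1)).
by rewrite -(derive_val (is_derive := d2)) !derive_cst /= !eqxx.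
Qed.

Lemma Im_norm_le (z : R[i]) : `|complex.Im z|%:C <= `|z|.
Proof.
have := normc_ge_Re (z * 'i%C); rewrite ReiNIm normrN normrM.
suff -> : `|'i%C : R[i]| = 1 by rewrite mulr1.
by rewrite normc_def /= expr0n /= add0r expr1n sqrtr1.
Qed.

Lemma cderiv_quadratic (f : R -> R[i]) (x : R[i]) (C : R[i]) :
  (forall t, `|f t - f 0 - t%:C * x| <= C * t%:C ^+ 2) -> cderiv f x.
Proof.
move=> fC.
have le_C t (a : R) : `|a|%:C <= `|f t - f 0 - t%:C * x| ->
    `|a| <= complex.Re C * t ^+ 2.
  move/le_trans/(_ (fC t)); rewrite lecE => /andP[_] /=.
  by rewrite -rmorphXn /=; case: (C) => u v /=; rewrite mulr0 subr0.
split; apply: (is_derive_quadratic (C := complex.Re C)) => t; apply: le_C.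
  apply: le_trans (normc_ge_Re _); rewrite le_eqVlt; apply/orP; left.
  by case: (f t) (f 0) x {fC} => a b [c d] [u v] /=; rewrite mul0r subr0.
apply: le_trans (Im_norm_le _); rewrite le_eqVlt; apply/orP; left.
by case: (f t) (f 0) x {fC} => a b [c d] [u v] /=; rewrite mul0r addr0.
Qed.

Lemma tangentP n (M : set 'M[R[i]]_n) (H X : 'M[R[i]]_n) :
  tangent M H X <->
  exists c : R -> 'M[R[i]]_n,
    [/\ c 0 = H, \forall t \near (0 : R), M (c t) &
        forall i j, cderiv (fun t => c t i j) (X i j)].
Proof.
split=> [[c [c0 cM cRe cIm]]|[c [c0 cM dc]]]; exists c; split=> // i j.
  exact: (dc i j).1.
exact: (dc i j).2.
Qed.

Lemma cderiv_expi (a : R) : cderiv (fun t => expi (t * a)) ('i%C * a%:C).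
Proof.
have da : is_derive (0 : R) (1 : R) (fun t : R => t * a) a.
  have D := is_deriveM (is_derive_id (0 : R) (1 : R))
    (is_derive_cst a (0 : R) (1 : R)).
  by apply: (is_derive_eq D); rewrite /GRing.scale /= mulr0 add0r mulr1.
split => /=.
  have D := @is_derive1_comp R cos (fun t => t * a) 0 _ _ (is_derive_cos _) da.
  by apply: (is_derive_eq D); rewrite /= [0 * a]mul0r sin0; ring.
have D := @is_derive1_comp R sin (fun t => t * a) 0 _ _ (is_derive_sin _) da.
by apply: (is_derive_eq D); rewrite /= [0 * a]mul0r cos0; ring.
Qed.

Lemma cderivM_cst (z : R[i]) f x :
  cderiv f x -> cderiv (fun t => z * f t) (z * x).
Proof.
move=> df; have dz : cderiv (fun=> z^*%R) 0 by split; exact: is_derive_cst.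
have := cderivMJ df dz; rewrite conjC0 mulr0 addr0 conjCK mulrC.
by under eq_fun do rewrite mulrC.
Qed.

Lemma norm_expi (x : R) : `|expi x| = 1 :> R[i].
Proof. by rewrite normc_def /= cos2Dsin2 sqrtr1. Qed.

Lemma norm1_mulJ (z : R[i]) : `|z| = 1 <-> z * z^*%R = 1.
Proof.
split=> [z1|]; first by rewrite -normCK z1 expr1n.
by rewrite -normCK => /eqP; rewrite pexpr_eq1 // => /eqP.
Qed.

Lemma tangent_torus n (H X : 'M[R[i]]_n) : torus H ->
  (tangent (@torus R n) H X <->
   exists A : 'M[R]_n, forall i j, X i j = 'i%C * (A i j)%:C * H i j).
Proof.
move=> H1; have HJ i j : H i j * (H i j)^*%R = 1 by apply/norm1_mulJ.
split=> [/tangentP[c [c0 cT dc]]|[A XE]]; last first.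
  apply/tangentP; exists (fun t => \matrix_(i, j) (H i j * expi (t * A i j))).
  split.
  - apply/matrixP=> i j; rewrite mxE mul0r /expi cos0 sin0.
    by rewrite (_ : 1 +i* 0 = 1) ?mulr1.
  - by near=> t => i j; rewrite mxE normrM H1 norm_expi mulr1.
  move=> i j; rewrite XE mulrC; under eq_fun do rewrite mxE.
  exact/cderivM_cst/cderiv_expi.
(* As H_ij has inverse conj(H_ij), the equation X = iAH leaves only this choice of A. *)
exists (\matrix_(i, j) complex.Im (X i j * (H i j)^*%R)) => i j; rewrite mxE.
have := cderiv_near_cst (cderivMJ (dc i j) (dc i j)) (y := 1).
rewrite c0 => skew.
have {skew} : X i j * (H i j)^*%R + H i j * (X i j)^*%R = 0.
  by apply: skew; apply: filterS cT => t cT; apply/norm1_mulJ.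
have -> : H i j * (X i j)^*%R = (X i j * (H i j)^*%R)^*%R.
  by rewrite rmorphM /= conjCK mulrC.
rewrite -[in X in _ -> X = _](mulr1 (X i j)) -(HJ i j) mulrCA [H i j * _]mulrC.
case: (X i j * _) => u v /eqP; rewrite eq_complex /= => /andP[/eqP u0 _].
congr (_ * _); apply/eqP; rewrite eq_complex /=.
have -> : u = 0 by lra.
by apply/andP; split; apply/eqP; ring.
Unshelve. all: by end_near.
Qed.

(** * Conjugate transposes and scaled unitary matrices *)

Lemma conjC_realc (x : R) : (x%:C)^*%R = x%:C.
Proof. exact: conjc_real. Qed.

Lemma adjM m n p (A : 'M[R[i]]_(m, n)) (B : 'M[R[i]]_(n, p)) :
  (A *m B)^t* = B^t* *m A^t*.
Proof. by rewrite trmx_mul map_mxM. Qed.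

Lemma adjD m n (A B : 'M[R[i]]_(m, n)) : (A + B)^t* = A^t* + B^t*.
Proof. by rewrite linearD map_mxD. Qed.

Lemma adjN m n (A : 'M[R[i]]_(m, n)) : (- A)^t* = - A^t*.
Proof. by rewrite linearN map_mxN. Qed.

Lemma adjZ m n a (A : 'M[R[i]]_(m, n)) : (a *: A)^t* = a^*%R *: A^t*.
Proof. by rewrite linearZ map_mxZ. Qed.

Lemma adj1 n : (1%:M : 'M[R[i]]_n)^t* = 1%:M.
Proof. by rewrite trmx1 map_mx1. Qed.

Lemma adjK m n (A : 'M[R[i]]_(m, n)) : (A^t*)^t* = A.
Proof. by apply/matrixP => i j; rewrite !mxE conjCK. Qed.

Lemma mulmxJE m n p (A : 'M[R[i]]_(m, n)) (B : 'M[R[i]]_(p, n)) i j :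
  (A *m B^t*) i j = \sum_k A i k * (B j k)^*%R.
Proof. by rewrite mxE; apply: eq_bigr => k _; rewrite !mxE. Qed.

Lemma mulmxJ_eq0 n (v : 'rV[R[i]]_n) : v *m v^t* = 0 -> v = 0.
Proof.
move/matrixP/(_ ord0 ord0); rewrite mulmxJE mxE => /eqP.
rewrite psumr_eq0 => [/allP v0|k _]; last exact: mul_conjC_ge0.
apply/rowP=> k; rewrite mxE; apply/eqP.
by have := v0 k (mem_index_enum _); rewrite mul_conjC_eq0.
Qed.

Lemma sqrtC_natJ n : (sqrtC n%:R : R[i]) * (sqrtC n%:R)^*%R = n%:R.
Proof. by rewrite geC0_conj ?sqrtC_ge0 ?ler0n // -expr2 sqrtCK. Qed.

Lemma scaled_unitaryP n (H : 'M[R[i]]_n) : (0 < n)%N ->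
  scaled_unitary H <-> H *m H^t* = n%:R%:M.
Proof.
move=> n_gt0; have n_neq0 : n%:R != 0 :> R[i] by rewrite pnatr_eq0 -lt0n.
split=> [[U /= /unitarymxP UU <-]|HH].
  rewrite linearZ map_mxZ /= -scalemxAl -scalemxAr UU.
  by rewrite scalerA sqrtC_natJ scalemx1.
exists ((sqrtC n%:R)^-1 *: H); last first.
  by rewrite scalerA divff ?scale1r // sqrtC_eq0.
apply/unitarymxP; rewrite linearZ map_mxZ /= -scalemxAl -scalemxAr HH scalerA.
by rewrite fmorphV -invfM sqrtC_natJ -scalemx1 scalerA mulVf // scale1r.
Qed.

(** A row has squared norm n, so |H_ij|^2 <= n <= n^2. This bound, coarser than sqrt(n), suffices to
    control the Cayley curve uniformly in t. *)
Lemma scaled_unitary_bound n (H : 'M[R[i]]_n) i j : (0 < n)%N ->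
  scaled_unitary H -> `|H i j| <= n%:R.
Proof.
move=> n_gt0 /(scaled_unitaryP _ n_gt0) /matrixP/(_ i i).
rewrite mulmxJE !mxE eqxx mulr1n (bigD1 j) //= => HE.
have : `|H i j| ^+ 2 <= n%:R.
  by rewrite -HE normCK lerDl sumr_ge0 // => k _; rewrite mul_conjC_ge0.
move=> H2; rewrite -(@ler_pXn2r _ 2) ?nnegrE ?ler0n //.
by apply: le_trans H2 _; rewrite -natrX ler_nat -{1}(expn1 n) leq_pexp2l.
Qed.

Lemma scaled_unitary_mul n (U H : 'M[R[i]]_n) :
  U \is unitarymx -> scaled_unitary H -> scaled_unitary (U *m H).
Proof.
move=> Uu [V Vu <-]; exists (U *m V); last by rewrite scalemxAr.
exact: mul_unitarymx.
Qed.

(** * The Cayley transform of a skew-Hermitian matrix *)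

Section Cayley.
Variables (n : nat) (K : 'M[R[i]]_n).
Hypothesis K_skew : K^t* = - K.

(** Rational in t, with value 1 and velocity [K] at t = 0: a stand-in for exp(tK). *)
Definition cayley (t : R) : 'M[R[i]]_n :=
  invmx (1%:M - (t / 2)%:C *: K) *m (1%:M + (t / 2)%:C *: K).

(* If [v = s v K] then [v v^* = s v K v^* = - v (s v K)^* = - v v^*]. *)
Lemma cayley_den_unit (s : R) : 1%:M - s%:C *: K \in unitmx.
Proof.
rewrite -row_free_unit -kermx_eq0; apply/rowV0P => v /sub_kermxP.
rewrite mulmxBr mulmx1 -scalemxAr => /subr0_eq vE; apply: mulmxJ_eq0.
have KvJ : K *m v^t* = - (v *m K)^t* by rewrite adjM K_skew mulNmx opprK.
have : v *m v^t* = - (v *m v^t*).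
  rewrite {1}vE -scalemxAl -mulmxA KvJ {4}vE adjZ conjC_realc.
  by rewrite mulmxN scalerN scalemxAr.
by move/eqP; rewrite -addr_eq0 -mulr2n -scaler_nat scaler_eq0 pnatr_eq0 => /eqP.
Qed.

(** Multiplying out the denominator gives this implicit equation; using it twice exhibits the
    second-order remainder of the curve. *)
Lemma cayleyE t :
  cayley t - 1%:M = (t / 2)%:C *: (K *m (cayley t + 1%:M)).
Proof.
have dU := cayley_den_unit (t / 2).
have e : cayley t = 1%:M + (t / 2)%:C *: K + (t / 2)%:C *: (K *m cayley t).
  apply/(canRL (subrK _)); rewrite scalemxAl -{1}[cayley t]mul1mx -mulmxBl.
  by rewrite mulmxA mulmxV // mul1mx.
by rewrite {1}e mulmxDr mulmx1 scalerDr addrAC [1%:M + _]addrC addrK addrC.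
Qed.

(** Numerator and denominator are adjoint to each other because [K] is skew-Hermitian, and they
    commute as polynomials in [K]. *)
Lemma cayley_unitary t : cayley t \is unitarymx.
Proof.
rewrite /cayley; set M := 1%:M - _; set P := 1%:M + _.
have MJ : M^t* = P.
  by rewrite adjD adjN adjZ adj1 conjC_realc K_skew scalerN opprK.
have PJ : P^t* = M by rewrite -MJ adjK.
have MU : M \in unitmx := cayley_den_unit (t / 2).
have PM : P *m M = M *m P.
  rewrite /P /M mulmxBr mulmx1 mulmxBl mul1mx; congr (_ - _).
  by rewrite mulmxDl mulmxDr mul1mx mulmx1.
have PiM : P *m (invmx M)^t* = 1%:M.
  by apply: mulmx1C; rewrite -MJ -adjM mulmxV // adj1.
apply/unitarymxP; rewrite adjM PJ mulmxA -[invmx M *m P *m M]mulmxA PM.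
by rewrite mulmxA mulVmx // mul1mx.
Qed.
End Cayley.

(** The equation is the derivative of H H^* = n. Conversely, it makes K = X H^* / n skew-Hermitian
    with X = KH, and the Cayley curve of K applied to H has velocity X. *)
Lemma tangent_scaled_unitary n (H X : 'M[R[i]]_n) : (0 < n)%N ->
  scaled_unitary H ->
  tangent (@scaled_unitary R n) H X <->
  X *m H^t* + H *m X^t* = 0.
Proof.
move=> n_gt0 HU; have n_neq0 : n%:R != 0 :> R[i] by rewrite pnatr_eq0 -lt0n.
have HH := (scaled_unitaryP H n_gt0).1 HU.
split=> [/tangentP[c [c0 cU dc]]|skew].
  apply/matrixP => i j; rewrite mxE !mulmxJE -big_split mxE /=.
  have D := cderiv_sum (fun k => cderivMJ (dc i k) (dc j k)).
  rewrite c0 in D; apply: (cderiv_near_cst D (y := (n%:R%:M : 'M[R[i]]_n) i j)).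
  apply: filterS cU => t /(scaled_unitaryP _ n_gt0) /matrixP/(_ i j) <-.
  by rewrite mulmxJE.
pose K := n%:R^-1 *: (X *m H^t*).
have K_skew : K^t* = - K.
  rewrite adjZ fmorphV /= conjC_nat adjM adjK -scalerN; congr (_ *: _).
  by apply/eqP; rewrite -addr_eq0 addrC skew.
have XE : X = K *m H.
  have /mulmx1C : H *m (n%:R^-1 *: H^t*) = 1%:M.
    by rewrite -scalemxAr HH -scalemx1 scalerA mulVf // scale1r.
  by move=> HJH; rewrite /K -scalemxAl -mulmxA scalemxAr scalemxAl HJH mulmx1.
have CH t : scaled_unitary (cayley K t *m H).
  exact/scaled_unitary_mul/HU/cayley_unitary.
apply/tangentP; exists (fun t => cayley K t *m H); split.
- by rewrite /cayley mul0r scale0r subr0 addr0 invmx1 !mul1mx.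
- by near=> t.
move=> i j.
(* The rows of [cayley K t *m H] are bounded, so this is [O(t^2)]. *)
have cE t : cayley K t *m H - H - t%:C *: X =
    t%:C ^+ 2 *: (4^-1 *: (K *m K *m (cayley K t *m H + H))).
  have CE := cayleyE K_skew t; set C := cayley K t in CE *.
  have -> : t%:C = (t / 2)%:C * 2 :> R[i].
    by rewrite -(rmorph_nat (real_complex R)) -rmorphM /= divfK // pnatr_eq0.
  set s := (t / 2)%:C in CE *.
  (* Removing tX = 2sKH leaves sK(C - 1)H; a second use of [CE] supplies the other factor s. *)
  have -> : C *m H - H - (s * 2) *: X = (s *: (K *m (C - 1%:M))) *m H.
    have -> : C *m H - H = (C - 1%:M) *m H by rewrite mulmxBl mul1mx.
    rewrite XE {1}CE [(s * 2) *: _]scalemxAl -mulmxBl.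
    congr (_ *m _); rewrite mulmxBr mulmxDr !mulmx1 -scalerA -scalerBr.
    by rewrite scaler_nat mulr2n opprD addrA addrK.
  have -> : C *m H + H = (C + 1%:M) *m H by rewrite mulmxDl mul1mx.
  rewrite CE -scalemxAr scalerA.
  rewrite mulmxA -scalemxAl mulmxA scalerA; congr (_ *: _).
  by field.
(* The factor n + n bounds an entry of the curve plus an entry of [H]. *)
pose Q := 4^-1 *: (K *m K); pose C := \sum_k `|Q i k| * (n%:R + n%:R).
apply: (cderiv_quadratic (C := C)) => t.
rewrite [cayley K 0]/cayley mul0r scale0r subr0 addr0 invmx1 !mul1mx.
move: (cE t) (CH t); rewrite scalemxAl -/Q.
move: (cayley K t *m H) Q @C => D Q C DE DU.
have := congr1 (fun M : 'M[R[i]]_n => M i j) DE; rewrite !mxE => ->.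
have t2_ge0 : 0 <= t%:C ^+ 2 :> R[i] by rewrite -rmorphXn ler0c sqr_ge0.
rewrite normrM (ger0_norm t2_ge0) mulrC; apply: ler_wpM2r => //.
apply: le_trans (ler_norm_sum _ _ _) _; apply: ler_sum => k _.
rewrite normrM ler_wpM2l // mxE (le_trans (ler_normD _ _)) // lerD //.
  exact: scaled_unitary_bound DU.
exact: scaled_unitary_bound HU.
Unshelve. all: by end_near.
Qed.

End Tangent.

(** * Characters and the real (Hartley) transform *)

Section Fourier.
Variable R : realType.
Local Open Scope complex_scope.

Lemma expiD (x y : R) : expi (x + y) = expi x * expi y.
Proof.
rewrite /expi cosD sinD; apply/eqP; rewrite eq_complex /=.
by apply/andP; split; apply/eqP; ring.
Qed.

Lemma expi0 : expi (0 : R) = 1.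
Proof. by rewrite /expi cos0 sin0. Qed.

Lemma expi_2pin (m : nat) : expi (2 * pi * m%:R) = 1 :> R[i].
Proof.
elim: m => [|m IHm]; first by rewrite mulr0 expi0.
rewrite -[m.+1%:R]natr1 mulrDr expiD IHm mul1r mulr1 mulr_natl.
by rewrite /expi cos2pi sin2pi.
Qed.

Lemma expi_modn (m n : nat) : (0 < n)%N ->
  expi (2 * pi * (m %% n)%:R / n%:R) = expi (2 * pi * m%:R / n%:R) :> R[i].
Proof.
move=> n_gt0; have n_neq0 : n%:R != 0 :> R by rewrite pnatr_eq0 -lt0n.
rewrite {2}(divn_eq m n) natrD natrM.
have -> : 2 * pi * ((m %/ n)%:R * n%:R + (m %% n)%:R) / n%:R =
    2 * pi * (m %/ n)%:R + 2 * pi * (m %% n)%:R / n%:R :> R by field.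
by rewrite expiD expi_2pin mul1r.
Qed.

(** With x half the angle, cos 2x = 1 would force sin x = 0, impossible for 0 < x < pi. *)
Lemma expi_neq1 (m n : nat) : (0 < m < n)%N ->
  expi (2 * pi * m%:R / n%:R) != 1 :> R[i].
Proof.
move=> /andP[m_gt0 mn]; have n_gt0 : 0 < n%:R :> R.
  by rewrite ltr0n (leq_ltn_trans _ mn).
pose x : R := pi * m%:R / n%:R.
have x_in : 0 < x < pi.
  rewrite /x divr_gt0 // ?mulr_gt0 ?pi_gt0 ?ltr0n //=.
  by rewrite ltr_pdivrMr // ltr_pM2l ?pi_gt0 // ltr_nat.
have xE : x *+ 2 = 2 * pi * m%:R / n%:R by rewrite /x; ring.
rewrite -xE.
apply/negP => /eqP /(congr1 (@complex.Re R)) /=.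
rewrite mulr2n cosD -!expr2 => cos2x; have cs := cos2Dsin2 x.
have /eqP : sin x ^+ 2 = 0 by lra.
by rewrite expf_eq0 /= (gt_eqF (sin_gt0_pi x_in)).
Qed.

Section Character.
Variable N : seq nat.
Hypothesis N_gt0 : forall m, m \in N -> (0 < m)%N.
Notation G := (Zprod N).

(** The Fourier entries indexed by group elements, so that multiplicativity in each argument can be
    stated. *)
Definition chi (x y : G) : R[i] :=
  \prod_(s < size N)
    expi (2 * pi * (Zcoord x s * Zcoord y s)%:R / (nth 0%N N s)%:R).

Lemma fourierE i j : fourier R N i j = chi (enum_val i) (enum_val j).
Proof. by rewrite mxE. Qed.

Lemma nth_gt0 (s : 'I_(size N)) : (0 < nth 0%N N s)%N.
Proof. by apply: N_gt0; rewrite mem_nth. Qed.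

Lemma chiC x y : chi x y = chi y x.
Proof. by apply: eq_bigr => s _; rewrite mulnC. Qed.

Lemma ZcoordM (x y : G) s :
  Zcoord (x * y)%g s = ((Zcoord x s + Zcoord y s) %% nth 0%N N s)%N.
Proof. by rewrite /Zcoord ffunE /=; congr modn; rewrite prednK ?nth_gt0. Qed.

Lemma chiMl x y z : chi (x * y)%g z = chi x z * chi y z.
Proof.
rewrite -big_split; apply: eq_bigr => s _ /=.
rewrite -expiD -mulrDl -mulrDr -natrD -mulnDl.
rewrite -[RHS]expi_modn ?nth_gt0 // ZcoordM -modnMml expi_modn ?nth_gt0 //.
Qed.

Lemma chi1 z : chi 1%g z = 1.
Proof.
by apply: big1 => s _; rewrite /Zcoord ffunE /= mul0n mulr0 mul0r expi0.
Qed.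

Lemma norm_chi x y : `|chi x y| = 1.
Proof. by rewrite normr_prod; apply: big1 => s _; exact: norm_expi. Qed.

Lemma chi_mulJ x y : chi x y * (chi x y)^*%R = 1.
Proof. exact/norm1_mulJ/norm_chi. Qed.

Lemma chiV x y : chi x^-1%g y = (chi x y)^*%R.
Proof.
have : chi (x^-1 * x)%g y = 1 by rewrite mulVg chi1.
rewrite chiMl -{1}(chi_mulJ x y) [RHS]mulrC => /mulIf -> //.
by rewrite -normr_eq0 norm_chi oner_eq0.
Qed.

Lemma chi_neq1 x : x != 1%g -> exists y, chi x y != 1.
Proof.
move=> x_neq1; have [s xs] : exists s, Zcoord x s != 0%N.
  apply/existsP; apply: contraNT x_neq1; rewrite negb_exists => /forallP x0.
  apply/eqP/ffunP => s; apply: val_inj; rewrite ffunE /=.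
  by have := x0 s; rewrite negbK => /eqP.
have xs_lt : (Zcoord x s < nth 0%N N s)%N.
  by have := ltn_ord (x s); rewrite [X in (_ < X)%N]prednK ?nth_gt0.
(* [y] is a unit vector at a coordinate where [x] is nonzero; [inord 1] really is 1 there, since 0 <
   x_s < N_s. *)
pose y : G := [ffun t : 'I_(size N) => if t == s then inord 1 else inord 0].
have y_coord t : Zcoord y t = (t == s).
  rewrite /Zcoord ffunE; case: eqP => [->|_] /=; rewrite inordK //.
  rewrite prednK ?nth_gt0 //; apply: leq_ltn_trans xs_lt.
  by rewrite lt0n.
exists y; rewrite /chi (bigD1 s) //= big1 => [|t /negbTE ts].
  by rewrite mulr1 y_coord eqxx muln1 expi_neq1 // lt0n xs.
by rewrite y_coord ts muln0 mulr0 mul0r expi0.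
Qed.

(** For nontrivial x, translating the summation variable by z multiplies the sum by chi(x, z), which
    differs from 1 for some z. *)
Lemma sum_chi x : \sum_y chi x y = (#|G| * (x == 1%g))%:R.
Proof.
have [->|/chi_neq1[z xz]] := eqVneq.
  by under eq_bigr do rewrite chi1; rewrite sumr_const muln1.
rewrite muln0; apply/eqP; have : chi x z * \sum_y chi x y = \sum_y chi x y.
  rewrite mulr_sumr [RHS](reindex_inj (mulgI z)); apply: eq_bigr => y _ /=.
  by rewrite ![chi x _]chiC chiMl.
move/eqP; rewrite -subr_eq0 -{2}[\sum_y _]mul1r -mulrBl mulf_eq0 subr_eq0.
by rewrite (negbTE xz).
Qed.

Definition cas x y := complex.Re (chi x y) + complex.Im (chi x y).

Lemma casV x y : cas x^-1%g y = complex.Re (chi x y) - complex.Im (chi x y).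
Proof. by rewrite /cas chiV; case: (chi x y). Qed.

(** By (cos a + sin a)(cos b + sin b) = cos(a - b) + sin(a + b), this is the real part of one
    character sum plus the imaginary part of another; the latter vanishes, character sums being
    natural numbers. *)
Lemma sum_cas_cas x y : \sum_z cas x z * cas y z = (#|G| * (x == y))%:R.
Proof.
have e z : cas x z * cas y z =
    complex.Re (chi (x * y^-1)%g z) + complex.Im (chi (x * y)%g z).
  rewrite !chiMl chiV /cas; case: (chi x z) (chi y z) => a b [c d] /=; ring.
under eq_bigr do rewrite e.
have natE m : m%:R = (m%:R : R)%:C :> R[i] by rewrite rmorph_nat.
by rewrite big_split -Re_sum -Im_sum !sum_chi !natE /= addr0 -eq_mulgV1.
Qed.

Lemma sum_cas_casC x y : \sum_z cas z x * cas z y = (#|G| * (x == y))%:R.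
Proof.
by rewrite -sum_cas_cas; apply: eq_bigr => z _; rewrite /cas ![chi z _]chiC.
Qed.

Definition hartley (A : G -> G -> R) x g := \sum_k cas g k * A x k.

(** As chi_x conj(chi_y) = chi_g for g = x y^-1, the first condition compares the rows gy and y
    against chi_g; the real and imaginary parts add up to a comparison of Hartley coefficients at
    g. *)
Lemma hartley_invariant (A : G -> G -> R) :
  (forall x y, \sum_k chi x k * (chi y k)^*%R * (A x k - A y k)%:C = 0) <->
  (forall x g, hartley A (g * x)%g g = hartley A x g).
Proof.
have ReMr (z : R[i]) (a : R) : complex.Re (z * a%:C) = complex.Re z * a.
  by case: z => u v /=; rewrite mulr0 subr0.
have ImMr (z : R[i]) (a : R) : complex.Im (z * a%:C) = complex.Im z * a.
  by case: z => u v /=; rewrite mulr0 add0r.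
split=> [A0 x g|hA x y].
  apply/eqP; rewrite -subr_eq0 -sumrB; apply/eqP.
  have := A0 (g * x)%g x.
  under eq_bigr do rewrite chiMl -[X in X * _%:C]mulrA chi_mulJ mulr1.
  move=> S0; have := congr1 (fun z => complex.Re z + complex.Im z) S0.
  rewrite Re_sum Im_sum -big_split /= addr0 => e; rewrite -[RHS]e.
  apply: eq_bigr => k _.
  by rewrite ReMr ImMr /cas; ring.
(* The invariance for [g] gives Re + Im = 0 and that for [g^-1] gives
   Re - Im = 0, where Re and Im are the parts of the sum to be shown zero. *)
set g := (x * y^-1)%g; under eq_bigr do rewrite -chiV -chiMl -/g.
have xE : x = (g * y)%g by rewrite /g mulgKV.
have /eqP := hA y g; rewrite -xE -subr_eq0 -sumrB => /eqP sumE.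
have /eqP := hA x g^-1%g; rewrite {1}xE mulKg -subr_eq0 -sumrB => /eqP sumVE.
have sumP : \sum_k complex.Re (chi g k) * (A x k - A y k) +
    \sum_k complex.Im (chi g k) * (A x k - A y k) = 0.
  rewrite -big_split -[RHS]sumE /=; apply: eq_bigr => k _.
  by rewrite /cas; ring.
have sumM : \sum_k complex.Re (chi g k) * (A x k - A y k) -
    \sum_k complex.Im (chi g k) * (A x k - A y k) = 0.
  rewrite -sumrB -[RHS]oppr0 -[in RHS]sumVE -sumrN /=; apply: eq_bigr => k _.
  by rewrite casV; ring.
apply/eqP; rewrite eq_complex Re_sum Im_sum; under eq_bigr do rewrite ReMr.
under [X in _ && (X == _)]eq_bigr do rewrite ImMr.
by apply/andP; split; apply/eqP; rewrite /=; lra.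
Qed.

End Character.
End Fourier.

(** * Dimension count for the Fourier matrix *)

Lemma sum_enum_val (V : nmodType) (T : finType) (F : T -> V) :
  \sum_(i < #|T|) F (enum_val i) = \sum_x F x.
Proof. by rewrite [RHS](reindex _ (onW_bij _ (enum_val_bij T))). Qed.

Section DefectFourier.
Variables (R : realType) (N : seq nat).
Hypothesis N_gt0 : forall m, m \in N -> (0 < m)%N.
Notation G := (Zprod N).
Local Open Scope complex_scope.
Local Open Scope sesquilinear_scope.

Lemma card_Zprod_gt0 : (0 < #|G|)%N.
Proof. by apply/card_gt0P; exists 1%g. Qed.

Lemma fourier_torus : torus (fourier R N).
Proof. by move=> i j; rewrite fourierE norm_chi. Qed.

Lemma fourier_scaled_unitary : scaled_unitary (fourier R N).
Proof.
apply/scaled_unitaryP; first exact: card_Zprod_gt0.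
apply/matrixP => i j; rewrite mulmxJE.
under eq_bigr do rewrite !fourierE -chiV // -chiMl //.
rewrite (sum_enum_val (chi R _)).
rewrite sum_chi // -eq_mulgV1 (inj_eq enum_val_inj) !mxE.
by rewrite natrM mulr_natr.
Qed.

Lemma tangent_fourierP (X : 'M[R[i]]_#|G|) :
  (tangent (@torus R _) (fourier R N) `&`
    tangent (@scaled_unitary R _) (fourier R N))%classic X <->
  exists A : G -> G -> R,
    (forall i j, X i j =
       'i%C * (A (enum_val i) (enum_val j))%:C * fourier R N i j) /\
    (forall x g, hartley A (g * x)%g g = hartley A x g).
Proof.
(* For X = iAF, the sign from conjugating i turns linearized unitarity into i times the sum in
   [hartley_invariant]. *)
have skewE (A : G -> G -> R) :
    (forall i j, X i j =
       'i%C * (A (enum_val i) (enum_val j))%:C * fourier R N i j) ->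
    forall i j, (X *m (fourier R N)^t* + fourier R N *m X^t*) i j =
      'i%C * \sum_k chi R (enum_val i) k * (chi R (enum_val j) k)^*%R *
         (A (enum_val i) k - A (enum_val j) k)%:C.
  move=> XE i j; rewrite mxE !mulmxJE -big_split mulr_sumr /=.
  rewrite -[RHS]sum_enum_val.
  apply: eq_bigr => k _; rewrite !XE !fourierE !rmorphM /= conjC_realc.
  have -> : ('i%C : R[i])^*%R = - 'i%C.
    by apply/eqP; rewrite eq_complex /= oppr0 !eqxx.
  by rewrite rmorphB /=; ring.
have ten := tangent_scaled_unitary X card_Zprod_gt0 fourier_scaled_unitary.
split=> [[/(tangent_torus _ fourier_torus)[A XE] /ten skew]|[A [XE Ainv]]].
  pose A' x y := A (enum_rank x) (enum_rank y).
  have XE' i j : X i j =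
      'i%C * (A' (enum_val i) (enum_val j))%:C * fourier R N i j.
    by rewrite XE /A' !enum_valK.
  exists A'; split=> //; apply/hartley_invariant => // x y.
  have := skewE A' XE' (enum_rank x) (enum_rank y).
  rewrite skew mxE !enum_rankK => /esym/eqP; rewrite mulf_eq0.
  by case/orP=> [|/eqP //]; rewrite eq_complex /= oner_eq0 andbF.
split.
  apply/(tangent_torus _ fourier_torus).
  by exists (\matrix_(i, j) A (enum_val i) (enum_val j)) => i j; rewrite mxE XE.
apply/ten/matrixP => i j; rewrite (skewE A XE) mxE.
by rewrite (hartley_invariant N_gt0 A).2 // mulr0.
Qed.

(** One index per free Hartley coefficient: a frequency g and a coset of the subgroup it
    generates. *)
Definition orbit_type : finType :=
  {u : G * {set G} | u.2 \in rcosets <[u.1]>%g [set: G]%SET}.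

Lemma card_orbit_type : #|orbit_type| = (\sum_(g : G) #|G| %/ #[g]%g)%N.
Proof.
rewrite card_sig -sum1_card.
rewrite -(pair_big_dep xpredT
  (fun g U => U \in rcosets <[g]>%g [set: G]%SET) (fun _ _ => 1%N)) /=.
apply: eq_bigr => g _; rewrite sum1_card -/(indexg _ _).
by rewrite -divgS ?finset.subsetT // cardsT.
Qed.

Lemma mem_rcosetsT (g x : G) : (<[g]> :* x)%g \in rcosets <[g]>%g [set: G]%SET.
Proof. by apply/rcosetsP; exists x; rewrite ?inE. Qed.

Definition orbit_of (g x : G) : orbit_type :=
  exist _ (g, <[g]> :* x)%g (mem_rcosetsT g x).

Lemma orbit_ofM g x : orbit_of g (g * x)%g = orbit_of g x.
Proof.
apply: val_inj; rewrite /= rcosetM rcoset_id // cycle_id //.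
Qed.

Lemma orbit_ofP (u : orbit_type) : exists g x, u = orbit_of g x.
Proof.
case: u => [[g U] gU]; have /rcosetsP[x _ /= UE] := gU.
by exists g, x; apply: val_inj; rewrite /= UE.
Qed.

Lemma orbit_invariant_repr (B : G -> G -> R) :
  (forall x g, B (g * x)%g g = B x g) ->
  forall x g, B (repr (<[g]> :* x)%g) g = B x g.
Proof.
move=> Binv x g; have /rcosetP[y /cycleP[m ->] ->] := mem_repr_rcoset <[g]>%G x.
by elim: m => [|m IHm]; rewrite ?mul1g // expgS -mulgA Binv.
Qed.

(** The inverse Hartley transform, without the factor 1/|G|, of coefficients constant on cosets. *)
Definition defect_phase (h : 'rV[R]_#|orbit_type|) (x k : G) : R :=
  \sum_g cas R g k * h 0 (enum_rank (orbit_of g x)).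

Lemma hartley_defect_phase h x g :
  hartley (defect_phase h) x g = #|G|%:R * h 0 (enum_rank (orbit_of g x)).
Proof.
rewrite /hartley /defect_phase; under eq_bigr do rewrite mulr_sumr.
rewrite exchange_big /= (bigD1 g) //= [X in _ + X]big1 ?addr0 => [|g' g'g].
  under eq_bigr do rewrite mulrA.
  by rewrite -mulr_suml sum_cas_cas // eqxx muln1.
under eq_bigr do rewrite mulrA.
by rewrite -mulr_suml sum_cas_cas // eq_sym (negbTE g'g) muln0 mul0r.
Qed.

Lemma defect_phase_onto (A : G -> G -> R) :
  (forall x g, hartley A (g * x)%g g = hartley A x g) ->
  exists h, forall x k, A x k = defect_phase h x k.
Proof.
(* [h] stores the coefficients at coset representatives; 1/|G| compensates for the unnormalized
   [defect_phase]. *)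
move=> Ainv; pose h : 'rV[R]_#|orbit_type| := \row_i
  (#|G|%:R^-1 * hartley A (repr (val (enum_val i)).2) (val (enum_val i)).1).
exists h => x k; rewrite /defect_phase.
have N_neq0 : #|G|%:R != 0 :> R by rewrite pnatr_eq0 -lt0n card_Zprod_gt0.
under eq_bigr do
  rewrite mxE enum_rankK /= orbit_invariant_repr // mulrCA mulr_sumr.
rewrite -mulr_sumr exchange_big /= (bigD1 k) //=.
rewrite [X in _ * (_ + X)]big1 ?addr0 => [|l lk].
  under eq_bigr do rewrite mulrA.
  by rewrite -mulr_suml sum_cas_casC // eqxx muln1 mulrA mulVf ?mul1r.
under eq_bigr do rewrite mulrA.
by rewrite -mulr_suml sum_cas_casC // eq_sym (negbTE lk) muln0 mul0r.
Qed.

(** The real and imaginary parts of iAF with A the phase of [h], paired as in [has_real_dim]. *)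
Definition defect_vector (h : 'rV[R]_#|orbit_type|) : 'M[R]_#|G| * 'M[R]_#|G| :=
  (\matrix_(i, j) (- defect_phase h (enum_val i) (enum_val j) *
                     complex.Im (fourier R N i j)),
   \matrix_(i, j) (defect_phase h (enum_val i) (enum_val j) *
                     complex.Re (fourier R N i j))).

Lemma defect_phase_is_linear x k : scalar (fun h => defect_phase h x k).
Proof.
move=> a h h'; rewrite /defect_phase mulr_sumr -big_split /=.
by apply: eq_bigr => g _; rewrite !mxE /GRing.scale /=; ring.
Qed.

Lemma defect_vector_is_linear : linear defect_vector.
Proof.
move=> a h h'; rewrite /defect_vector.
by congr pair; apply/matrixP => i j; rewrite !mxE defect_phase_is_linear
  /GRing.scale /=; ring.
Qed.

HB.instance Definition _ :=
  GRing.isLinear.Build R 'rV[R]_#|orbit_type| ('M[R]_#|G| * 'M[R]_#|G|)%type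
    _ defect_vector defect_vector_is_linear.

Lemma defect_vectorP (X : 'M[R[i]]_#|G|) h :
  (map_mx (@complex.Re R) X, map_mx (@complex.Im R) X) = defect_vector h <->
  (forall i j, X i j =
    'i%C * (defect_phase h (enum_val i) (enum_val j))%:C * fourier R N i j).
Proof.
have mulE (a : R) (z : R[i]) :
    'i%C * a%:C * z = (- a * complex.Im z) +i* (a * complex.Re z).
  by case: z => u v; apply/eqP; rewrite eq_complex /=; apply/andP; split;
    apply/eqP; ring.
rewrite /defect_vector; move: (fourier R N) => F.
split=> [[/matrixP XRe /matrixP XIm] i j|XE].
  have := XRe i j; have := XIm i j; rewrite !mxE mulE.
  by case: (X i j) => u v /= -> ->.
by congr pair; apply/matrixP => i j; rewrite !mxE XE mulE.
Qed.

(** Fourier entries have modulus 1, so the phase vanishes; its Hartley transform then gives |G| h =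
    0. *)
Lemma defect_vector_inj h : defect_vector h = 0 -> h = 0.
Proof.
have N_neq0 : #|G|%:R != 0 :> R by rewrite pnatr_eq0 -lt0n card_Zprod_gt0.
move=> h0.
have /defect_vectorP phaseE :
    (map_mx (@complex.Re R) 0, map_mx (@complex.Im R) 0) = defect_vector h.
  by rewrite h0; congr pair; apply/matrixP => i j; rewrite !mxE.
have phase0 x k : defect_phase h x k = 0.
  have := phaseE (enum_rank x) (enum_rank k); rewrite mxE !enum_rankK fourierE.
  move/esym/eqP; rewrite !mulf_eq0 -(normr_eq0 (chi _ _ _)) norm_chi oner_eq0.
  rewrite orbF.
  by case/orP; rewrite eq_complex /= ?oner_eq0 ?andbF // => /andP[/eqP].
apply/rowP => i; rewrite mxE; have [g [x ix]] := orbit_ofP (enum_val i).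
have := hartley_defect_phase h x g; rewrite -ix enum_valK /hartley.
rewrite big1 => [/esym/eqP|k _]; last by rewrite phase0 mulr0.
by rewrite mulf_eq0 (negbTE N_neq0) => /eqP.
Qed.

Lemma defect_fourier : defect (fourier R N) = (\sum_(g : G) #|G| %/ #[g]%g)%N.
Proof.
rewrite -card_orbit_type /defect /real_dim.
pose U := limg (linfun defect_vector).
have SU X : (tangent (@torus R _) (fourier R N) `&`
    tangent (@scaled_unitary R _) (fourier R N))%classic X <->
    (map_mx (@complex.Re R) X, map_mx (@complex.Im R) X) \in U.
  rewrite tangent_fourierP; split=> [[A [XE /defect_phase_onto[h AE]]]|].
    apply/memv_imgP; exists h; rewrite ?memvf // lfunE; apply/defect_vectorP => i j.
    by rewrite XE AE.
  case/memv_imgP=> h _; rewrite lfunE => /defect_vectorP XE.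
  exists (defect_phase h); split=> // x g.
  by rewrite !hartley_defect_phase orbit_ofM.
have dimU : \dim U = #|orbit_type|.
  rewrite /U limg_dim_eq ?dimvf /dim /= ?mul1n //; apply/eqP.
  rewrite -subv0; apply/subvP => h; rewrite memv_cap memvf memv_ker lfunE /=.
  by move/eqP/defect_vector_inj ->; rewrite mem0v.
apply: xget_unique.
  by exists U.
(* Any other witness [V] equals [U], because each pair of real matrices comes from a complex one;
   hence the value chosen by [xget] is determined. *)
move=> d [V [SV <-]]; rewrite -dimU; congr (\dim _).
apply/vspaceP => -[M1 M2]; pose X := \matrix_(i, j) (M1 i j +i* M2 i j).
have -> : (M1, M2) = (map_mx (@complex.Re R) X, map_mx (@complex.Im R) X).
  by congr pair; apply/matrixP => i j; rewrite !mxE.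
by apply/idP/idP => [/SV/SU|/SU/SV].
Qed.

End DefectFourier.

(** * From the defect to the product of local factors *)

Local Open Scope classical_set_scope.

Theorem theorem5p6 (R : realType) (N : seq nat)
    (N_gt0 : forall m, m \in N -> (0 < m)%N)
    (a : nat -> seq nat)
    (a_sorted : forall p, prime p -> sorted leq (a p))
    (G_p : forall p, prime p ->
       exists2 P : {group Zprod N}, (p.-Sylow([set: Zprod N]%SET) P)%g &
         (P \isog [set: Zprod [seq (p ^ k)%N | k <- a p]]%SET)%g) :
  (defect (fourier R N))%:R =
  #|Zprod N|%:R *
    \big[*%R/1]_(p \in [set p | prime p]) local_factor p (a p) :> rat.
Proof.
rewrite defect_fourier // -(inv_order_sum_abelian (Zprod_abelian N) a_sorted G_p).
rewrite natr_sum /inv_order_sum mulr_sumr.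
apply: eq_big => [g|g _]; first by rewrite inE.
(* By Lagrange the natural quotient is exact, hence equals the rational one. *)
by rewrite natf_div // -cardsT order_dvdG ?inE.
Qed.
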